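(* Let $\mathfrak m\ne0$ be a distinguished multisegment, and let $c$ be the largest endpoint occurring among the segments of $\mathfrak m$. Then $\nu^{-1}\mathfrak m_c\le\mathfrak m_{c-1}$. Equivalently, $S_{\mathfrak m}(\Delta)\ge0$ for every segment $\Delta$ satisfying $\mathbf e(\Delta)=c-1$. Dually, if $a$ is the smallest beginning occurring among the segments of $\mathfrak m$, then $\nu\mathfrak m^a\le\mathfrak m^{a+1}$.
   Context: A segment is a set $[a,b]=\{a,a+1,\ldots,b\}$ of consecutive integers, $a\le b$; write $\mathbf b([a,b])=a$ (beginning), $\mathbf e([a,b])=b$ (endpoint), and $\mathrm{Sgm}$ for the set of segments. Put $\nu[a,b]=[a+1,b+1]$. A multisegment is a finitely supported function $\mathfrak m:\mathrm{Sgm}\to\mathbb Z_{\ge0}$ (a finite multiset of segments); sums and $\le$ are pointwise; $(\nu^n\mathfrak m)(\Delta)=\mathfrak m(\nu^{-n}\Delta)$. For $x\in\mathbb Z$, $\mathfrak m_x$ (resp. $\mathfrak m^x$) is the sub-multiset of all segments of $\mathfrak m$ with endpoint $x$ (resp. beginning $x$), with multiplicity. Define $S_{\mathfrak m}(\Delta)=\sum_{t\ge0}(-1)^t\mathfrak m(\nu^t\Delta)$ (a finite sum). An order of $\mathfrak m$ is a listing $(\Delta_1,\ldots,\Delta_k)$ in which each segment $\Delta$ occurs exactly $\mathfrak m(\Delta)$ times. Write $[a,b]\prec[a',b']$ if $a<a'$, $b<b'$ and $b\ge a'-1$. An order is standard if $\Delta_i\not\prec\Delta_j$ whenever $i<j$.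 A decomposition of a segment $\Delta$ is a tuple of segments $(\Delta_1,\ldots,\Delta_r)$, $r\ge1$, with $\mathbf e(\Delta_1)=\mathbf e(\Delta)$, $\mathbf b(\Delta_r)=\mathbf b(\Delta)$ and $\mathbf e(\Delta_{i+1})=\mathbf b(\Delta_i)-1$ for $1\le i\le r-1$. A decomposition of an order $(\Delta_1,\ldots,\Delta_k)$ is a choice of a decomposition $(\Delta_{i,1},\ldots,\Delta_{i,k_i})$ of each $\Delta_i$; its index set is $I=\{(i,j):1\le i\le k,\ 1\le j\le k_i\}$, ordered lexicographically ($\prec_{\mathrm{lex}}$), and $(i,j)\ll(i',j')$ means $i<i'$. The decomposition is relevant to the order if there is an involution $\tau:I\to I$ with: (R1) $\tau(i,j+1)\ll\tau(i,j)$ for all $1\le i\le k$, $1\le j\le k_i-1$; (R2) $\tau(\imath)\ne\imath$ for all $\imath\in I$; (R3) $\Delta_\imath=\nu\Delta_{\tau(\imath)}$ whenever $\imath\prec_{\mathrm{lex}}\tau(\imath)$. $\mathfrak m$ is distinguished if every standard order of $\mathfrak m$ admits a relevant decomposition. *)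

(* Defs.v *)
From HB Require Import structures.
From mathcomp Require Import all_boot all_order all_algebra.
From mathcomp Require Import finmap multiset.
From mathcomp Require Import classical_sets cardinality fsbigop.

Set Implicit Arguments.
Unset Strict Implicit.
Unset Printing Implicit Defensive.

Import Order.TTheory GRing.Theory Num.Theory.
Local Open Scope fset_scope.
Local Open Scope mset_scope.
Local Open Scope ring_scope.

(* The segment {a, a+1, ..., b} of consecutive integers is represented by its
   pair of ends (a, b), which determines it. *)
Definition is_segment : pred (int * int) := fun p => p.1 <= p.2.

Record segment := Segment { ends : int * int; endsP : is_segment ends }.

HB.instance Definition _ := [isSub for ends].
HB.instance Definition _ := [Countable of segment by <:].

Definition beg (D : segment) : int := (ends D).1.
Definition ept (D : segment) : int := (ends D).2.

Lemma shift_subproof (n : int) (D : segment) : is_segment (beg D + n, ept D + n).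
Proof. by rewrite /is_segment /= lerD2r; exact: (endsP D). Qed.

(* [shift n] is the n-th power of the translation nu, for n in Z. *)
Definition shift (n : int) (D : segment) : segment :=
  Segment (shift_subproof n D).

Lemma shift0 : shift 0 =1 id.
Proof. by move=> D; apply: val_inj; rewrite /= !addr0 -surjective_pairing. Qed.

Lemma shiftD (m n : int) (D : segment) : shift m (shift n D) = shift (n + m) D.
Proof. by apply: val_inj; rewrite /= /beg /ept /= !addrA. Qed.

Lemma shiftK (n : int) : cancel (shift n) (shift (- n)).
Proof. by move=> D; rewrite shiftD subrr shift0. Qed.

Definition multisegment := {mset segment}.

Fact mshift_key : unit. Proof. exact: tt. Qed.
Definition mshift (n : int) (m : multisegment) : multisegment :=
  [mset[mshift_key] D in shift n @` finsupp m => m (shift (- n) D)].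

Lemma mshiftE n m D : mshift n m D = m (shift (- n) D).
Proof.
rewrite fsfunE; case: ifPn => // DNm; apply/esym/eqP.
rewrite -[_ == _]negbK mset_neq0 -msuppE; apply: contra DNm => Dm.
by apply/imfsetP; exists (shift (- n) D); rewrite //= shiftD addNr shift0.
Qed.

Fact mfilter_key : unit. Proof. exact: tt. Qed.
Definition mfilter (P : pred segment) (m : multisegment) : multisegment :=
  [mset[mfilter_key] D in finsupp m => if P D then m D else 0%N].

Lemma mfilterE P m D : mfilter P m D = if P D then m D else 0%N.
Proof.
by rewrite fsfunE msuppE -mset_neq0; case: eqP => [->|//]; case: ifP.
Qed.

Definition with_ept (m : multisegment) (x : int) : multisegment :=
  mfilter (fun D => ept D == x) m.

Definition with_beg (m : multisegment) (x : int) : multisegment :=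
  mfilter (fun D => beg D == x) m.

(* Finitely supported sum over all t >= 0 (see [altsum_fin]). *)
Definition altsum (m : multisegment) (D : segment) : int :=
  \sum_(t \in [set: nat]) ((-1) ^+ t * (m (shift t%:Z D))%:Z).

Lemma altsum_fin (m : multisegment) (D : segment) (N : nat) :
  (forall t : nat, (N <= t)%N -> m (shift t%:Z D) = 0%N) ->
  altsum m D = \sum_(0 <= t < N) (-1) ^+ t * (m (shift t%:Z D))%:Z.
Proof.
move=> mN; rewrite /altsum (fsbigE (index_iota 0 N)) ?iota_uniq //.
- by apply: eq_bigl => t; rewrite in_setT.
- by move=> t _ + ; rewrite mem_index_iota /= -leqNgt => /mN->; rewrite mulr0.
Qed.

Lemma shift_eventually_notin (m : multisegment) (D : segment) :
  exists N : nat, forall t : nat, (N <= t)%N -> m (shift t%:Z D) = 0%N.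
Proof.
exists (\max_(D' <- finsupp m) `|ept D' - ept D|.+1)%N => t Nt.
apply/eqP; rewrite -[_ == _]negbK mset_neq0 -msuppE; apply/negP => Dm.
pose F (D' : segment) := `|ept D' - ept D|.+1%N.
have := leq_trans (leq_bigmax_seq (P := xpredT) (F := F) _ Dm isT) Nt.
by rewrite /F /ept /= addrC addKr ltnn.
Qed.

Definition largest_ept (m : multisegment) (c : int) : Prop :=
  (exists2 D, D \in m & ept D = c) /\ (forall D, D \in m -> ept D <= c).

Definition smallest_beg (m : multisegment) (a : int) : Prop :=
  (exists2 D, D \in m & beg D = a) /\ (forall D, D \in m -> a <= beg D).

Definition order_of (m : multisegment) (s : seq segment) : Prop :=
  forall D, count_mem D s = m D.

Definition precedes (D D' : segment) : bool :=
  [&& beg D < beg D', ept D < ept D' & beg D' - 1 <= ept D].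

Definition standard (s : seq segment) : bool :=
  pairwise (fun D D' => ~~ precedes D D') s.

Definition decomposition (D : segment) (ds : seq segment) : bool :=
  if ds is D1 :: ds' then
    [&& ept D1 == ept D, beg (last D1 ds') == beg D &
        path (fun D' D'' => ept D'' == beg D' - 1) D1 ds']
  else false.

Definition order_decomposition (s : seq segment) (dss : seq (seq segment)) : bool :=
  all2 decomposition s dss.

(* The index set I of a decomposition of an order, with indices counted from 0,
   as a subset of nat * nat. *)
Definition index_set (dss : seq (seq segment)) : pred (nat * nat) :=
  fun p => (p.1 < size dss)%N && (p.2 < size (nth [::] dss p.1))%N.

Definition segment0 : segment := @Segment (0, 0) (lexx 0).

Definition piece (dss : seq (seq segment)) (p : nat * nat) : segment :=
  nth segment0 (nth [::] dss p.1) p.2.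

Definition ltlex (p q : nat * nat) : bool :=
  (p.1 < q.1)%N || ((p.1 == q.1) && (p.2 < q.2)%N).

(* Only the restriction of [tau] to the index set matters. *)
Definition relevant (dss : seq (seq segment)) : Prop :=
  exists tau : nat * nat -> nat * nat,
    [/\ forall p, index_set dss p -> index_set dss (tau p) /\ tau (tau p) = p,
        forall i j : nat, index_set dss (i, j.+1) ->
          ((tau (i, j.+1)).1 < (tau (i, j)).1)%N,
        forall p, index_set dss p -> tau p <> p
      & forall p, index_set dss p -> ltlex p (tau p) ->
          piece dss p = shift 1 (piece dss (tau p))].

Definition distinguished (m : multisegment) : Prop :=
  forall s, order_of m s -> standard s ->
    exists2 dss, order_decomposition s dss & relevant dss.

(* Main.v *)
Require Import Defs.
From mathcomp Require Import all_boot all_order all_algebra.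
From mathcomp Require Import finmap multiset.
From mathcomp Require Import zify.

Set Implicit Arguments.
Unset Strict Implicit.
Unset Printing Implicit Defensive.

Import Order.TTheory GRing.Theory Num.Theory.
Local Open Scope mset_scope.
Local Open Scope ring_scope.

(** In a suitable standard order, a relevant decomposition cannot cut
    the segments that end at the largest endpoint c, and its involution then
    maps them injectively to their translates.

    List first the segments ending at c, longest first, and then all the others
    by decreasing beginning (lemma [sweep_standard]).  Let Delta_i end at c and
    suppose that the claim holds for the segments before it: they are uncut and
    are paired with uncut segments outside the group ending at c.  Then no piece
    of Delta_i can be paired backwards, so each is nu of its partner, and these
    partners lie in later segments, the further to the right a piece is in
    Delta_i, the later.  The partner of a piece is the leftmost piece of its own
    segment, since a piece after it would have to be paired with a segment
    before Delta_i.  Hence a piece with beginning u has its partner in a segment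
    with beginning u - 1.  For the last piece of Delta_i, this segment starts
    just left of Delta_i, so it is outside the group ending at c, whose later
    members start no further left than Delta_i.  From there on beginnings never
    increase, whereas the partners of the earlier pieces would lie later and
    start further right: so Delta_i has a single piece, and its partner has
    endpoint c - 1, so it is the whole of a segment nu^(-1) Delta_i.  This is
    [sweep_uncut]; counting gives nu^(-1) m_c <= m_(c-1).

    The statement about beginnings follows by the duality [a, b] -> [-b, -a].
    Combined with the reversal of an order and of each of its decompositions, it
    exchanges beginnings with endpoints and preserves standardness
    ([standard_dual]) and relevance ([relevant_dual]).

    As for S_m, a segment ending at c - 1 has at most one translate by a positive
    power of nu in m, which leaves a sum of two terms ([altsum_top]). *)

Implicit Types (D : segment) (ds s : seq segment) (dss : seq (seq segment)).
Implicit Types (m : multisegment) (c : int).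

(** * Segments, translates and multiplicities *)

Lemma segment_eq D D' : beg D = beg D' -> ept D = ept D' -> D = D'.
Proof.
by move=> bDD' eDD'; apply: val_inj; rewrite /= [LHS]surjective_pairing
   [RHS]surjective_pairing; congr pair.
Qed.

Lemma beg_le_ept D : beg D <= ept D.
Proof. exact: endsP D. Qed.

Lemma altsum_top m c D : largest_ept m c -> ept D = c - 1 ->
  altsum m D = (m D)%:Z - (m (shift 1 D))%:Z.
Proof.
move=> [_ m_le] eD; rewrite (@altsum_fin m D 2).
  by rewrite big_nat_recl // big_nat1 expr0 mul1r expr1 mulN1r shift0.
move=> t t_ge2; apply/eqP/contraT; rewrite mset_neq0 => /m_le.
rewrite /ept /= -/(ept D) eD; lia.
Qed.

Lemma msub_shift_with_ept m c :
  mshift (-1) (with_ept m c) `<=` with_ept m (c - 1) <->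
  forall D, ept D = c - 1 -> (m (shift 1 D) <= m D)%N.
Proof.
have e1 D : (ept (shift 1 D) == c) = (ept D == c - 1).
  by rewrite [LHS]eq_sym [RHS]eq_sym subr_eq eq_sym.
split=> [/msubsetP sub D eD | le_m]; last first.
  apply/msubsetP => D; rewrite mshiftE !mfilterE opprK e1.
  by case: eqP => // /le_m.
by have := sub D; rewrite mshiftE !mfilterE opprK e1 eD eqxx.
Qed.

Lemma count_mem_le_inj (T : eqType) (x0 : T) (s : seq T) (x y : T)
    (f : nat -> nat) :
  (forall i, (i < size s)%N -> nth x0 s i = x ->
     (f i < size s)%N /\ nth x0 s (f i) = y) ->
  {in [pred i | (i < size s)%N && (nth x0 s i == x)] &, injective f} ->
  (count_mem x s <= count_mem y s)%N.
Proof.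
move=> fP f_inj.
have cE z : count_mem z s =
    size [seq i <- iota 0 (size s) | nth x0 s i == z].
  by rewrite -{1}(mkseq_nth x0 s) /mkseq count_map size_filter.
have memE z i : i \in [seq i <- iota 0 (size s) | nth x0 s i == z] =
   (i < size s)%N && (nth x0 s i == z).
  by rewrite mem_filter mem_iota add0n andbC.
rewrite !cE -(size_map f); apply: uniq_leq_size.
  rewrite map_inj_in_uniq ?filter_uniq ?iota_uniq // => i j.
  by rewrite !memE => iP jP; apply: f_inj.
move=> _ /mapP[i + ->]; rewrite !memE => /andP[lt_is /eqP/(fP _ lt_is)[-> ->]].
exact: eqxx.
Qed.

(** * Pieces of a decomposition *)

Lemma decomposition_size D ds : decomposition D ds -> (0 < size ds)%N.
Proof. by case: ds. Qed.

Lemma decomposition_ept D ds :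
  decomposition D ds -> ept (nth segment0 ds 0) = ept D.
Proof. by case: ds => //= D1 ds /and3P[/eqP]. Qed.

Lemma decomposition_beg D ds :
  decomposition D ds -> beg (nth segment0 ds (size ds).-1) = beg D.
Proof. by rewrite nth_last; case: ds => //= D1 ds /and3P[_ /eqP]. Qed.

Lemma decomposition_step D ds j : decomposition D ds -> (j.+1 < size ds)%N ->
  ept (nth segment0 ds j.+1) = beg (nth segment0 ds j) - 1.
Proof.
by case: ds => //= D1 ds /and3P[_ _ /(pathP segment0) dsP] /dsP/eqP.
Qed.

Lemma decomposition_ept_lt D ds j : decomposition D ds ->
  (0 < j < size ds)%N -> ept (nth segment0 ds j) < ept D.
Proof.
move=> dsP; elim: j => [//|[_ /andP[_ lt1]|j IHj /andP[_ lt_j]]].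
  rewrite (decomposition_step dsP lt1) -(decomposition_ept dsP).
  have := beg_le_ept (nth segment0 ds 0); lia.
rewrite (decomposition_step dsP lt_j).
have := beg_le_ept (nth segment0 ds j.+1); have := IHj (ltnW lt_j); lia.
Qed.

Lemma order_decomposition_nth s dss : order_decomposition s dss ->
  size dss = size s /\ forall i, (i < size s)%N ->
    decomposition (nth segment0 s i) (nth [::] dss i).
Proof.
rewrite /order_decomposition all2E => /andP[/eqP sz /(all_nthP (segment0, [::])) dP].
split=> // i lt_is; have := dP i; rewrite size_zip -sz minnn => /(_ lt_is).
by rewrite nth_zip.
Qed.

(** * The standard order adapted to the endpoint c *)

(** Among the segments ending at [c] any order is standard; ascending beginnings
    are what keeps the partner of the last piece out of this group. *)
Definition sweep (c : int) (s : seq segment) : seq segment :=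
  sort (fun D D' => beg D <= beg D') [seq D <- s | ept D == c] ++
  sort (fun D D' => beg D' <= beg D) [seq D <- s | ept D != c].

Lemma perm_sweep c s : perm_eq (sweep c s) s.
Proof.
rewrite /sweep perm_sym -(perm_filterC (fun D => ept D == c) s) perm_sym.
by apply: perm_cat; rewrite perm_sort.
Qed.

Lemma pairwise_beg_asc s :
  pairwise (fun D D' => beg D <= beg D') (sort (fun D D' => beg D <= beg D') s).
Proof.
rewrite -sorted_pairwise; first by apply: sort_sorted => D D'; apply: le_total.
by move=> D2 D1 D3; apply: le_trans.
Qed.

Lemma pairwise_beg_desc s :
  pairwise (fun D D' => beg D' <= beg D) (sort (fun D D' => beg D' <= beg D) s).
Proof.
rewrite -sorted_pairwise; first by apply: sort_sorted => D D'; apply: le_total.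
by move=> D2 D1 D3 le21 le32; apply: le_trans le32 le21.
Qed.

Lemma sweep_standard c s : all (fun D => ept D <= c) s -> standard (sweep c s).
Proof.
move=> /allP s_le; rewrite /standard pairwise_cat; apply/and3P; split.
- apply/allrelP => D D'; rewrite !mem_sort !mem_filter.
  move=> /andP[/eqP eD _] /andP[_ /s_le eD']; rewrite /precedes eD; lia.
- apply: (@sub_in_pairwise _ (fun D => ept D == c)) (pairwise_beg_asc _).
    by move=> D D' /eqP eD /eqP eD' _; rewrite /precedes eD eD' ltxx andbF.
  by rewrite all_sort filter_all.
- apply: sub_pairwise (pairwise_beg_desc _) => D D' /= le_bD.
  by rewrite /precedes ltNge le_bD.
Qed.

Lemma sweep_nth c s (n := count (fun D => ept D == c) s)
    (D := nth segment0 (sweep c s)) : all (fun E => ept E <= c) s ->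
  [/\ (n <= size s)%N,
      forall i, (i < n)%N -> ept (D i) = c,
      forall i, (n <= i < size s)%N -> ept (D i) < c,
      forall i j, (i <= j < n)%N -> beg (D i) <= beg (D j)
    & forall i j, (n <= i <= j)%N && (j < size s)%N -> beg (D j) <= beg (D i)].
Proof.
move=> /allP s_le; rewrite {}/D /sweep.
set G := sort _ _; set R := sort _ _.
have szG : size G = n by rewrite size_sort size_filter.
have szGR : (n + size R = size s)%N.
  by rewrite -szG -size_cat (perm_size (perm_sweep c s)).
split=> [||i /andP[ni lt_is]|i j /andP[]|i j /andP[/andP[ni]]].
- exact: count_size.
- move=> i lt_in; rewrite nth_cat szG lt_in; apply/eqP.
  have : nth segment0 G i \in G by rewrite mem_nth ?szG.
  by rewrite mem_sort mem_filter => /andP[].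
- rewrite nth_cat szG ltnNge ni /=.
  have : nth segment0 R (i - n) \in R by rewrite mem_nth // ltn_subLR ?szGR.
  by rewrite mem_sort mem_filter => /andP[neq_c /s_le]; rewrite lt_neqAle neq_c.
- rewrite leq_eqVlt => /orP[/eqP<- //|lt_ij] lt_jn.
  have /(pairwiseP segment0) G_asc := pairwise_beg_asc [seq E <- s | ept E == c].
  rewrite !nth_cat szG lt_jn (ltn_trans lt_ij lt_jn).
  by apply: (G_asc i j) => //; rewrite inE -/G szG // (ltn_trans lt_ij).
- rewrite leq_eqVlt => /orP[/eqP<- //|lt_ij] lt_js.
  have /(pairwiseP segment0) R_desc := pairwise_beg_desc [seq E <- s | ept E != c].
  rewrite !nth_cat szG !ltnNge ni (leq_trans ni (ltnW lt_ij)) /=.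
  by apply: (R_desc (i - n)%N (j - n)%N); rewrite ?inE -/R; lia.
Qed.

(** * Segments ending at c are not cut *)

Definition relevant_involution dss (tau : nat * nat -> nat * nat) : Prop :=
  [/\ forall p, index_set dss p -> index_set dss (tau p) /\ tau (tau p) = p,
      forall i j : nat, index_set dss (i, j.+1) ->
        ((tau (i, j.+1)).1 < (tau (i, j)).1)%N,
      forall p, index_set dss p -> tau p <> p
    & forall p, index_set dss p -> ltlex p (tau p) ->
        piece dss p = shift 1 (piece dss (tau p))].

Lemma relevant_involution_lt dss tau i j l : relevant_involution dss tau ->
  (j < l)%N -> index_set dss (i, l) -> ((tau (i, l)).1 < (tau (i, j)).1)%N.
Proof.
move=> [_ tau_lt _ _]; elim: l => // l IHl; rewrite ltnS leq_eqVlt.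
case/orP=> [/eqP<-|lt_jl] lI; first exact: tau_lt.
apply: ltn_trans (tau_lt _ _ lI) (IHl lt_jl _).
by case/andP: lI => /= ? ?; apply/andP; split=> //=; apply: ltnW.
Qed.

(** The involution reverses the order of the pieces of one segment, so two
    pieces of the same segment that are exchanged would violate (R1). *)
Lemma relevant_involution_neq1 dss tau p : relevant_involution dss tau ->
  index_set dss p -> (tau p).1 != p.1.
Proof.
move=> tauP pI; have [tauI _ tau_neq _] := tauP.
have [tpI ttp] := tauI _ pI; have := tau_neq _ pI.
case: p pI tpI ttp => i j; case tp: (tau _) => [i' l] /= pI tpI ttp neq.
apply/eqP => eq_i; rewrite {}eq_i in tp tpI ttp neq.
case: (ltngtP j l) => [lt_jl|lt_lj|eq_jl]; last by case: neq; rewrite eq_jl.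
  by have := relevant_involution_lt tauP lt_jl tpI; rewrite tp ttp ltnn.
by have := relevant_involution_lt tauP lt_lj pI; rewrite tp ttp ltnn.
Qed.

(** The first [n] segments of [sweep c s] are those that end at [c].  In
    the induction, that the earlier segments are uncut and paired outside this
    group excludes backward partners; that they are paired with first pieces
    excludes that a piece following a partner is paired with them. *)
Lemma sweep_uncut c s dss tau (n := count (fun D => ept D == c) s) :
    all (fun D => ept D <= c) s -> order_decomposition (sweep c s) dss ->
    relevant_involution dss tau ->
  forall i, (i < n)%N ->
    [/\ size (nth [::] dss i) = 1%N, (n <= (tau (i, 0%N)).1)%N,
        (tau (i, 0%N)).2 = 0%N & size (nth [::] dss (tau (i, 0%N)).1) = 1%N].
Proof.
move=> s_le /order_decomposition_nth[sz_dss dec] tauP.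
have [le_ns ept_top ept_low asc desc] := sweep_nth s_le.
rewrite -/n in le_ns ept_top ept_low asc desc.
rewrite (perm_size (perm_sweep c s)) in sz_dss dec.
have [tauI tau_lt _ tau_piece] := tauP.
elim/ltn_ind=> i IHi lt_in.
have lt_is : (i < size s)%N := leq_trans lt_in le_ns.
have IE p q : index_set dss (p, q) = (p < size s)%N && (q < size (nth [::] dss p))%N.
  by rewrite /index_set /= sz_dss.
(* No piece is paired backwards: the earlier segments are already paired with
   segments outside the first group. *)
have up j : (j < size (nth [::] dss i))%N -> (i < (tau (i, j)).1)%N.
  move=> lt_j; have ijI : index_set dss (i, j) by rewrite IE lt_is.
  have := relevant_involution_neq1 tauP ijI.
  rewrite neq_ltn => /orP[|//] /= lt_i'i.
  have [] := tauI _ ijI; case: (tau _) lt_i'i => i' l /= lt_i'i.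
  have [sz1 le_n _ _] := IHi _ lt_i'i (ltn_trans lt_i'i lt_in).
  rewrite IE sz1 ltnS leqn0 => /andP[_ /eqP->] eq_tau; rewrite eq_tau /= in le_n.
  by rewrite leqNgt lt_in in le_n.
(* The partner is the leftmost piece of its segment: by (R1) a next piece would
   be paired with a segment before the i-th one. *)
have partner j : (j < size (nth [::] dss i))%N -> let p := (tau (i, j)).1 in
    [/\ (p < size s)%N, (tau (i, j)).2 = (size (nth [::] dss p)).-1,
        (0 < size (nth [::] dss p))%N,
        piece dss (i, j) = shift 1 (piece dss (tau (i, j)))
      & beg (piece dss (i, j)) = beg (nth segment0 (sweep c s) p) + 1].
  move=> lt_j; have ijI : index_set dss (i, j) by rewrite IE lt_is.
  have [] := tauI _ ijI; have := up j lt_j; have := tau_piece _ ijI.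
  case: (tau _) => p l /= pieceE lt_ip; rewrite IE => /andP[lt_ps lt_l] tau_pl.
  have sz_p := decomposition_size (dec _ lt_ps).
  have l_last : l = (size (nth [::] dss p)).-1.
    apply/eqP; rewrite eqn_leq -ltnS prednK // lt_l /= leqNgt -ltnS prednK //.
    apply/negP => lt_l1.
    have plI : index_set dss (p, l.+1) by rewrite IE lt_ps.
    have := tau_lt _ _ plI; rewrite tau_pl /=.
    have [] := tauI _ plI; case: (tau _) => i' l' + + lt_i'i.
    have [sz1 _ tau2 _] := IHi _ lt_i'i (ltn_trans lt_i'i lt_in).
    rewrite IE sz1 ltnS leqn0 => /andP[_ /eqP->] eq_tau.
    by rewrite eq_tau in tau2.
  have {}pieceE : piece dss (i, j) = shift 1 (piece dss (p, l)).
    by apply: pieceE; rewrite /ltlex lt_ip.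
  split=> //; rewrite pieceE /beg /= -/(beg _) {1}/piece /= l_last.
  by congr (_ + _); apply: decomposition_beg (dec _ lt_ps).
have sz_i := decomposition_size (dec _ lt_is).
pose k := (size (nth [::] dss i)).-1.
have lt_k : (k < size (nth [::] dss i))%N by rewrite prednK.
have [lt_ps _ _ _] := partner _ lt_k.
rewrite {1}/piece /= (decomposition_beg (dec _ lt_is)).
set p := (tau (i, k)).1 in lt_ps * => beg_p.
have le_np : (n <= p)%N.
  rewrite leqNgt; apply/negP => lt_pn.
  have := asc i p; rewrite lt_pn andbT => /(_ (ltnW (up _ lt_k))); lia.
(* With a piece j before the last piece k, the partner segments p' of j and p of
   k satisfy p < p', whereas p' begins further right than p: outside the
   first group beginnings never increase. *)
have sz1 : size (nth [::] dss i) = 1%N.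
  apply/eqP; rewrite eqn_leq sz_i andbT leqNgt; apply/negP => sz2.
  pose j := k.-1; have kE : k = j.+1 by rewrite /j prednK // /k; lia.
  have lt_j : (j < size (nth [::] dss i))%N by rewrite ltnW // -kE.
  have [lt_p's _ _ _] := partner _ lt_j.
  have ikI : index_set dss (i, k) by rewrite IE lt_is.
  have := tau_lt i j; rewrite -kE => /(_ ikI); rewrite -/p.
  set p' := (tau (i, j)).1 => lt_pp' beg_p'.
  have := desc p p'; rewrite le_np (ltnW lt_pp') lt_p's => /(_ isT).
  have := decomposition_step (dec _ lt_is) (j := j).
  rewrite -kE => /(_ lt_k) ept_k.
  have := beg_le_ept (nth segment0 (nth [::] dss i) k).
  rewrite ept_k /k (decomposition_beg (dec _ lt_is)).
  move: beg_p'; rewrite {1}/piece /=; lia.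
have k0 : k = 0%N by rewrite /k sz1.
have [_ last_p sz_p pieceE _] := partner _ lt_k.
rewrite k0 in p lt_ps beg_p le_np last_p sz_p pieceE *; rewrite -/p in last_p sz_p.
(* Pieces ending at c - 1 are first pieces, since segment p ends before c. *)
have l0 : (tau (i, 0%N)).2 = 0%N.
  case: (posnP (tau (i, 0%N)).2) => // l_gt0.
  have := ept_low p; rewrite le_np lt_ps => /(_ isT).
  have lt_l : (0 < (tau (i, 0%N)).2 < size (nth [::] dss p))%N.
    by rewrite l_gt0 last_p ltn_predL.
  have := decomposition_ept_lt (dec _ lt_ps) lt_l.
  have := congr1 ept pieceE.
  rewrite {1}/piece /= (decomposition_ept (dec _ lt_is)) ept_top //.
  rewrite [ept (shift _ _)]/ept /= -/(ept _) /piece -/p; lia.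
by split=> //; rewrite -(prednK sz_p) -last_p l0.
Qed.

Lemma sweep_count c s dss D : all (fun E => ept E <= c) s ->
    order_decomposition (sweep c s) dss -> relevant dss -> ept D = c ->
  (count_mem D s <= count_mem (shift (-1) D) s)%N.
Proof.
move=> s_le dssP [tau tauP] eD.
have uncut := sweep_uncut s_le dssP tauP.
have [sz_dss dec] := order_decomposition_nth dssP.
have [le_ns _ ept_low _ _] := sweep_nth s_le.
rewrite -!(permP (perm_sweep c s)).
have sz_s := perm_size (perm_sweep c s).
have top i : (i < size (sweep c s))%N -> nth segment0 (sweep c s) i = D ->
    (i < count (fun D => ept D == c) s)%N.
  move=> lt_is Di; rewrite ltnNge; apply/negP => le_ni.
  by have := ept_low i; rewrite le_ni -sz_s lt_is Di eD ltxx => /(_ isT).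
have [tauI _ _ tau_piece] := tauP.
have uncutE i : (i < size (sweep c s))%N -> size (nth [::] dss i) = 1%N ->
    piece dss (i, 0%N) = nth segment0 (sweep c s) i.
  move=> lt_is sz1; apply: segment_eq; rewrite /piece /=.
    by rewrite -(decomposition_beg (dec _ lt_is)) sz1.
  by rewrite (decomposition_ept (dec _ lt_is)).
apply: (@count_mem_le_inj _ segment0 _ _ _ (fun i => (tau (i, 0%N)).1)).
  move=> i lt_is Di; have lt_in := top i lt_is Di.
  have [sz1 le_n tau2 sz1'] := uncut _ lt_in.
  have iI : index_set dss (i, 0%N) by rewrite /index_set /= sz_dss lt_is sz1.
  have [+ _] := tauI _ iI; have := tau_piece _ iI.
  have lt_ip := leq_trans lt_in le_n.
  rewrite /ltlex lt_ip => /(_ isT).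
  case: (tau _) le_n tau2 sz1' lt_ip => p l /= le_n -> sz1' lt_ip.
  rewrite /index_set /= sz_dss sz1' => + /andP[lt_ps _].
  rewrite !uncutE // Di => ->; split=> //.
  by rewrite -[-1]/(- 1) shiftK.
move=> i j /andP[lt_is /eqP Di] /andP[lt_js /eqP Dj] /= eq_tau1.
have [sz_i _ tau_i2 _] := uncut _ (top i lt_is Di).
have [sz_j _ tau_j2 _] := uncut _ (top j lt_js Dj).
have iI : index_set dss (i, 0%N) by rewrite /index_set /= sz_dss lt_is sz_i.
have jI : index_set dss (j, 0%N) by rewrite /index_set /= sz_dss lt_js sz_j.
suff: (i, 0%N) = (j, 0%N) by case.
rewrite -(tauI _ iI).2 -(tauI _ jI).2; congr tau.
by rewrite [LHS]surjective_pairing [RHS]surjective_pairing eq_tau1 tau_i2 tau_j2.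
Qed.

(** * Duality *)

Lemma dual_subproof D : is_segment (- ept D, - beg D).
Proof. by rewrite /is_segment /= lerN2; apply: beg_le_ept. Qed.

Definition dual (D : segment) : segment := Segment (dual_subproof D).

Lemma beg_dual D : beg (dual D) = - ept D. Proof. by []. Qed.

Lemma ept_dual D : ept (dual D) = - beg D. Proof. by []. Qed.

Lemma dualK : involutive dual.
Proof. by move=> D; apply: segment_eq; rewrite !(beg_dual, ept_dual) opprK. Qed.

Lemma dual_shift k D : dual (shift k D) = shift (- k) (dual D).
Proof. by apply: segment_eq; rewrite /beg /ept /= opprD. Qed.

Lemma precedes_dual D D' : precedes (dual D) (dual D') = precedes D' D.
Proof.
rewrite /precedes !beg_dual !ept_dual !ltrN2 andbA [X in X && _]andbC -andbA.
by congr [&& _, _ & _]; lia.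
Qed.

Lemma count_mem_map_dual D s : count_mem D (map dual s) = count_mem (dual D) s.
Proof.
rewrite count_map; apply: eq_count => E /=.
by rewrite (can2_eq dualK dualK).
Qed.

Lemma standard_dual s : standard s -> standard (rev (map dual s)).
Proof.
rewrite /standard; elim: s => //= D s IHs /andP[D_s /IHs s_std].
rewrite rev_cons -cats1 pairwise_cat s_std /= andbT.
rewrite allrel1r all_rev all_map; apply: sub_all D_s => E /=.
by rewrite precedes_dual.
Qed.

Lemma decomposition_dual D ds :
  decomposition D ds -> decomposition (dual D) (rev (map dual ds)).
Proof.
case: ds => [//|D1 ds] /and3P[/eqP eD1 /eqP bD ds_path].
have sorted_rev : sorted (fun E E' => ept E' == beg E - 1)
    (rev (map dual (D1 :: ds))).
  rewrite rev_sorted sorted_map /=; apply: sub_path ds_path => E E' /= /eqP.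
  by rewrite ept_dual beg_dual => ->; apply/eqP; lia.
case: (lastP ds) => [|ds' D2] in ds_path bD sorted_rev *.
  by rewrite /= beg_dual ept_dual eD1 bD !eqxx.
move: sorted_rev; rewrite /= map_rcons rev_cons rev_rcons /= last_rcons => ->.
by rewrite last_rcons in bD; rewrite !ept_dual !beg_dual eD1 bD !eqxx.
Qed.

Definition dual_decomposition (dss : seq (seq segment)) : seq (seq segment) :=
  rev (map (fun ds => rev (map dual ds)) dss).

Lemma order_decomposition_dual s dss : order_decomposition s dss ->
  order_decomposition (rev (map dual s)) (dual_decomposition dss).
Proof.
rewrite /order_decomposition /dual_decomposition.
rewrite !all2E !size_rev !size_map => /andP[/eqP sz dec]; rewrite sz eqxx /=.
rewrite -rev_zip ?size_map // all_rev.
elim: s dss {sz} dec => [|D s IHs] [|ds dss] //= /andP[D_ds /IHs->].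
by rewrite andbT decomposition_dual.
Qed.

(** The position in [dss] of the piece that reversal moves to position [p];
    positions count from 0, whence the successors. *)
Definition flip (dss : seq (seq segment)) (p : nat * nat) : nat * nat :=
  ((size dss - p.1.+1)%N, (size (nth [::] dss (size dss - p.1.+1)) - p.2.+1)%N).

Lemma nth_dual_decomposition dss i : (i < size dss)%N ->
  nth [::] (dual_decomposition dss) i =
  rev (map dual (nth [::] dss (size dss - i.+1))).
Proof.
move=> lt_i; rewrite /dual_decomposition nth_rev ?size_map // (nth_map [::]) //.
lia.
Qed.

Lemma size_dual_decomposition dss : size (dual_decomposition dss) = size dss.
Proof. by rewrite size_rev size_map. Qed.

Lemma dual_decompositionK : involutive dual_decomposition.
Proof.
move=> dss; rewrite /dual_decomposition map_rev revK -map_comp map_id_in //.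
by move=> ds _ /=; rewrite map_rev revK mapK //; apply: dualK.
Qed.

Lemma index_set_flip dss p : index_set (dual_decomposition dss) p ->
  index_set dss (flip dss p).
Proof.
rewrite /index_set size_dual_decomposition => /andP[lt1].
by rewrite nth_dual_decomposition // size_rev size_map /=; lia.
Qed.

Lemma flipK dss p : index_set (dual_decomposition dss) p ->
  flip (dual_decomposition dss) (flip dss p) = p.
Proof.
rewrite /index_set size_dual_decomposition => /andP[lt1].
rewrite nth_dual_decomposition // size_rev size_map /= => lt2.
rewrite /flip /= size_dual_decomposition subnSK // subKn 1?ltnW //.
rewrite nth_dual_decomposition // size_rev size_map subnSK // subKn 1?ltnW //.
by case: p lt1 lt2.
Qed.

Lemma piece_flip dss p : index_set (dual_decomposition dss) p ->
  piece (dual_decomposition dss) p = dual (piece dss (flip dss p)).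
Proof.
rewrite /index_set size_dual_decomposition => /andP[lt1].
rewrite nth_dual_decomposition // size_rev size_map => lt2.
rewrite /piece nth_dual_decomposition // nth_rev size_map //.
by rewrite (nth_map segment0) //; lia.
Qed.

Lemma ltlex_flip dss p q : index_set (dual_decomposition dss) p ->
    index_set (dual_decomposition dss) q ->
  ltlex p q -> ltlex (flip dss q) (flip dss p).
Proof.
rewrite /index_set size_dual_decomposition => /andP[p1 p2] /andP[q1 q2].
move: p2 q2; rewrite !nth_dual_decomposition // !size_rev !size_map => p2 q2.
rewrite /ltlex /flip /=; case/orP=> [lt1|/andP[/eqP eq1 lt2]].
  by apply/orP; left; lia.
by apply/orP; right; rewrite eq1 eqxx in p2 *; lia.
Qed.

(** Reversal and duality each turn (R3) around, so conjugating the involution by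
    [flip] restores it; (R1) is preserved because it is reversed both within a
    segment and between segments. *)
Lemma relevant_dual dss : relevant dss -> relevant (dual_decomposition dss).
Proof.
case=> tau [tauI tau_lt tau_neq tau_piece].
set dss' := dual_decomposition dss.
have dssK : dual_decomposition dss' = dss by apply: dual_decompositionK.
have flipI' p : index_set dss p -> index_set dss' (flip dss' p).
  by move=> pI; apply: index_set_flip; rewrite dssK.
have flipK' p : index_set dss p -> flip dss (flip dss' p) = p.
  by move=> pI; rewrite -{1}dssK flipK // dssK.
exists (fun p => flip dss' (tau (flip dss p))); split.
- move=> p pI; have fI := index_set_flip pI; have [tI ttK] := tauI _ fI.
  by split; [exact: flipI' | rewrite flipK' // ttK flipK].
- move=> i j ijI.
  have ij0I : index_set dss' (i, j).
    by case/andP: ijI => /= ? ?; apply/andP; split=> //=; apply: ltnW.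
  have := index_set_flip ij0I; have fI := index_set_flip ijI.
  have [+ _] := tauI _ fI.
  have -> : flip dss (i, j) = ((flip dss (i, j.+1)).1, (flip dss (i, j.+1)).2.+1).
    rewrite /flip /=; congr pair.
    move: ijI; rewrite /index_set size_dual_decomposition => /andP[lt1].
    by rewrite nth_dual_decomposition // size_rev size_map /=; lia.
  case: (flip dss (i, j.+1)) fI => i' j' /= fI' tI fI''; have := tau_lt _ _ fI''.
  case/andP: tI => + _; rewrite size_dual_decomposition; lia.
- move=> p pI /= eq_p; have fI := index_set_flip pI.
  apply: (tau_neq _ fI); rewrite -{2}eq_p flipK' //.
  by have [] := tauI _ fI.
- move=> p pI lt_p; have fI := index_set_flip pI; have [tI ttK] := tauI _ fI.
  have := ltlex_flip pI (flipI' _ tI) lt_p; rewrite flipK' // => lt_t.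
  rewrite !piece_flip ?flipI' // flipK' //.
  have := tau_piece _ tI; rewrite ttK => /(_ lt_t) ->.
  by rewrite dual_shift -{1}[1]opprK shiftK.
Qed.

(** * Distinguished multisegments *)

Lemma distinguished_ept m c D : distinguished m -> largest_ept m c ->
  ept D = c -> (m D <= m (shift (-1) D))%N.
Proof.
move=> m_dist [_ m_le] eD.
have s_le : all (fun E => ept E <= c) (enum_mset m) by apply/allP.
have orderP : order_of m (sweep c (enum_mset m)).
  by move=> E; rewrite (permP (perm_sweep _ _)) count_mem_mset.
have [dss dssP dss_rel] := m_dist _ orderP (sweep_standard s_le).
by have := sweep_count s_le dssP dss_rel eD; rewrite !count_mem_mset.
Qed.

Lemma distinguished_beg m a D : distinguished m -> smallest_beg m a ->
  beg D = a -> (m D <= m (shift 1 D))%N.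
Proof.
move=> m_dist [_ m_ge] bD.
pose s := map dual (enum_mset m).
have s_le : all (fun E => ept E <= - a) s.
  by rewrite all_map; apply/allP => E /m_ge; rewrite /= ept_dual lerN2.
pose t := rev (map dual (sweep (- a) s)).
have orderP : order_of m t.
  move=> E; rewrite count_rev count_mem_map_dual (permP (perm_sweep _ _)).
  by rewrite count_mem_map_dual dualK count_mem_mset.
have [dss dssP /relevant_dual dss_rel] :=
  m_dist _ orderP (standard_dual (sweep_standard s_le)).
have := order_decomposition_dual dssP.
rewrite map_rev revK (mapK dualK) => dssP'.
have := sweep_count s_le dssP' dss_rel (D := dual D).
rewrite ept_dual bD => /(_ erefl); rewrite -dual_shift.
by rewrite !count_mem_map_dual !dualK !count_mem_mset.
Qed.

Theorem theorem1p5 (m : multisegment) (m_neq0 : m <> mset0) :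
  (forall c : int, largest_ept m c ->
     (mshift (-1) (with_ept m c) `<=` with_ept m (c - 1) <->
      forall D : segment, ept D = c - 1 -> 0 <= altsum m D)) /\
  (distinguished m ->
     (forall c : int, largest_ept m c ->
        mshift (-1) (with_ept m c) `<=` with_ept m (c - 1) /\
        (forall D : segment, ept D = c - 1 -> 0 <= altsum m D)) /\
     (forall a : int, smallest_beg m a ->
        mshift 1 (with_beg m a) `<=` with_beg m (a + 1))).
Proof.
have iff c : largest_ept m c ->
    (mshift (-1) (with_ept m c) `<=` with_ept m (c - 1) <->
     forall D : segment, ept D = c - 1 -> 0 <= altsum m D).
  move=> cP; rewrite msub_shift_with_ept.
  by split=> mP D eD; have := mP D eD; rewrite (altsum_top cP eD) subr_ge0.
split=> // m_dist; split=> [c cP | a aP].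
  have sub : mshift (-1) (with_ept m c) `<=` with_ept m (c - 1).
    rewrite msub_shift_with_ept => D eD.
    have := distinguished_ept (D := shift 1 D) m_dist cP.
    rewrite shiftK; apply.
    by rewrite [LHS]/ept /= -/(ept D) eD subrK.
  by split=> //; apply/iff.
apply/msubsetP => D; rewrite mshiftE !mfilterE.
have -> : (beg (shift (-1) D) == a) = (beg D == a + 1).
  by rewrite [LHS]subr_eq.
case: eqP => // bD.
have := distinguished_beg (D := shift (-1) D) m_dist aP.
have -> : shift 1 (shift (-1) D) = D by rewrite shiftD addNr shift0.
by apply; rewrite [LHS]/beg /= -/(beg D) bD addrK.
Qed.
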